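(* Let $G$ be a group, $\mathsf V=\mathsf{Al}(T,\Sigma)$ a variety of algebras containing nontrivial algebras, and $(\theta,\mathcal A)\in\mathsf{pA}(G,\mathsf V)$. The pair $(\boldsymbol\theta^{\mathbf U}_{\mathsf V},\mathcal W_{\mathsf V}(\mathcal A^U))$, where $$\boldsymbol\theta^{\mathbf U}_{\mathsf V}(x,[[w]_\Phi]_{\Theta_{\mathsf V}})=[[\overline{\theta^U}(x,w)]_\Phi]_{\Theta_{\mathsf V}}$$ for $x\in G$ and $w\in W(A^U)$, is an $\mathsf A(G,\mathsf V)$-reflector of $(\theta,\mathcal A)$. The reflector morphism is $a\mapsto[[[1,a]]_\Phi]_{\Theta_{\mathsf V}}$, i.e. it maps $a\in A$ to the class of the one-letter word $[1,a]\in W(A^U)$.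
   Context: Partial actions. A partial action of a group $G$ on a set $A$ is a partial map $\theta:G\times A\dashrightarrow A$ such that for all $x,y\in G$, $a\in A$: (i) $\theta(1,a)$ is defined and equals $a$; (ii) if $\theta(x,a)$ is defined, then $\theta(x^{-1},\theta(x,a))$ is defined and equals $a$; (iii) if $\theta(y,a)$ and $\theta(x,\theta(y,a))$ are defined, then $\theta(xy,a)$ is defined and equals $\theta(x,\theta(y,a))$. It is global if everywhere defined. One writes $xa$ for $\theta(x,a)$. The domain $D_x$ is $\{\theta(x,a)\mid a\in A,\ \theta(x,a)\text{ defined}\}$, and $\theta_x=\theta(x,-)$ is a bijection $D_{x^{-1}}\to D_x$. A type of algebras is a sequence $T=\{n_\gamma\}_{\gamma<o(T)}$ of non-negative integers indexed by ordinals; algebras of type $T$ have total operations $f_\gamma$ of arity $n_\gamma$, partial algebras have partial operations. $\mathsf V=\mathsf{Al}(T,\Sigma)$ is the class of algebras of type $T$ satisfying all identities of the set $\Sigma$ (identities over a set $Y$). $\mathsf{pA}(G,\mathsf V)$ is the category of pairs $(\theta,\mathcal A)$ with $\mathcal A\in\mathsf V$ and $\theta$ a partial action of $G$ on the set $A$ such that every $D_x$ is a subalgebra $\mathcal D_x$ of $\mathcal A$ and every $\theta_x:\mathcal D_{x^{-1}}\to\mathcal D_x$ is an isomorphism. Morphisms $(\theta,\mathcal A)\to(\theta',\mathcal A')$ are homomorphisms $\varphi$ such that whenever $\theta(x,a)$ is defined, $\theta'(x,\varphi(a))$ is defined and equals $\varphi(\theta(x,a))$. $\mathsf A(G,\mathsf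 V)$ is the full subcategory of pairs with global $\theta$. The partial algebra $\mathcal A^U$. $A^U=(G\times A)/{\sim}$, where $(x,a)\sim(y,b)$ iff $(y^{-1}x)a$ is defined and equals $b$; $[x,a]$ is the class of $(x,a)$; $\theta^U$ is the global action $x[y,a]=[xy,a]$. $\mathcal A^U$ is the partial algebra on $A^U$ with $f_\gamma([x,a_1],\dots,[x,a_{n_\gamma}])=[x,f_\gamma(a_1,\dots,a_{n_\gamma})]$ for $x\in G$, $a_i\in A$, and $f_\gamma$ undefined on tuples not of this form (for $n_\gamma=0$, $f_\gamma=[1,f_\gamma]$); this is well defined. Free algebras. $\mathcal W(X)$, with underlying set $W(X)$, is the free algebra of type $T$ over the set $X$ (formal terms, called words, in letters from $X$). $\overline{\theta^U}$ is the action of $G$ on $\mathcal W(A^U)$ applying $\theta^U(x,-)$ to each letter of a word. $\Phi$ is the congruence on $\mathcal W(X)$ generated by the pairs $(\varphi(w),\varphi(w'))$ with $(w=w')\in\Sigma$ and $\varphi:\mathcal W(Y)\to\mathcal W(X)$ a homomorphism; $\mathcal W_{\mathsf V}(X)=\mathcal W(X)/\Phi$ is the free algebra over $X$ in $\mathsf V$. Since $\mathsf V$ contains nontrivial algebras, $X\to W_{\mathsf V}(X)$ is injective and $X$ is identified with its image. For a partial algebra $\mathcal C$ of type $T$ with underlying set $C$, $\Theta_{\mathsf V}$ is the congruence on $\mathcal W_{\mathsf V}(C)$ generated by the pairs $((f_\gamma)_{\mathcal W_{\mathsf V}(C)}(c_1,\dots,c_{n_\gamma}),(f_\gamma)_{\mathcal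 C}(c_1,\dots,c_{n_\gamma}))$ with $c_i\in C$ and $(f_\gamma)_{\mathcal C}(c_1,\dots,c_{n_\gamma})$ defined; $\mathcal W_{\mathsf V}(\mathcal C)=\mathcal W_{\mathsf V}(C)/\Theta_{\mathsf V}$. Here $\mathcal C=\mathcal A^U$. $[\cdot]_\Phi$ and $[\cdot]_{\Theta_{\mathsf V}}$ denote classes. Reflector. For a subcategory $\mathsf D$ of $\mathsf C$, a $\mathsf D$-reflector of $C\in\mathsf C$ is $R\in\mathsf D$ with a morphism $\varepsilon:C\to R$ (the reflector morphism) such that for all $D\in\mathsf D$ and $\varphi:C\to D$ there is a unique $\psi:R\to D$ in $\mathsf D$ with $\psi\circ\varepsilon=\varphi$. Here $\mathsf C=\mathsf{pA}(G,\mathsf V)$. *)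

(* Defs.v *)
From HB Require Import structures.
From mathcomp Require Import all_boot.
From mathcomp Require Import boolp classical_sets.

Set Implicit Arguments.
Unset Strict Implicit.
Unset Printing Implicit Defensive.

Local Open Scope classical_set_scope.
Local Open Scope quotient_scope.

Section Quotient.
Variables (A : Type) (r : A -> A -> Prop).

Record equivalence : Prop := Equivalence {
  equiv_refl : forall a, r a a;
  equiv_sym : forall a b, r a b -> r b a;
  equiv_trans : forall a b c, r a b -> r b c -> r a c }.

Hypothesis er : equivalence.

Let rb : rel {classic A} := fun a b => `[< r a b >].

Fact rb_refl : reflexive rb.
Proof. by move=> a; apply/asboolP; apply: equiv_refl. Qed.

Fact rb_sym : symmetric rb.
Proof. by move=> a b; apply/asboolP/asboolP; apply: equiv_sym. Qed.

Fact rb_trans : transitive rb.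
Proof.
by move=> b a c /asboolP ab /asboolP bc; apply/asboolP; apply: equiv_trans bc.
Qed.

(* [{classic A}] is [A] with a choice structure, which [{eq_quot _}] needs. *)
Definition quot : Type := {eq_quot (EquivRel rb rb_refl rb_sym rb_trans)}.

Definition cls (a : A) : quot :=
  \pi_{eq_quot (EquivRel rb rb_refl rb_sym rb_trans)} (a : {classic A}).

Definition rep (q : quot) : A :=
  repr (q : {eq_quot (EquivRel rb rb_refl rb_sym rb_trans)}).

Lemma repK (q : quot) : cls (rep q) = q.
Proof. exact: reprK. Qed.

Lemma clsP (a b : A) : cls a = cls b <-> r a b.
Proof.
by split=> [/eqmodP/asboolP //|ab]; apply/eqmodP; apply/asboolP.
Qed.

Lemma rep_cls (a : A) : r (rep (cls a)) a.
Proof. by apply/clsP; rewrite repK. Qed.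

End Quotient.

(* A set of operation symbols replaces the sequence indexed by an ordinal. *)
Record algtype : Type := AlgType { opsym : Type; arity : opsym -> nat }.

Section UniversalAlgebra.
Variable T : algtype.

Record algebra : Type := Algebra {
  acar :> Type;
  aop : forall g : opsym T, ('I_(arity g) -> acar) -> acar }.

Record palgebra : Type := PAlgebra {
  pcar :> Type;
  pop : forall g : opsym T, ('I_(arity g) -> pcar) -> option pcar }.

Definition homomorphism (A B : algebra) (f : A -> B) : Prop :=
  forall (g : opsym T) (t : 'I_(arity g) -> A), f (aop t) = aop (f \o t).

Definition isomorphism (A B : algebra) (f : A -> B) : Prop :=
  homomorphism f /\ bijective f.

(* Subalgebras may be empty when there are no nullary operations. *)
Definition subalgebra (A : algebra) (S : set A) : Prop :=
  forall (g : opsym T) (t : 'I_(arity g) -> A), (forall i, S (t i)) -> S (aop t).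

Definition subalg (A : algebra) (S : set A) (hS : subalgebra S) : algebra :=
  @Algebra {a : A | S a} (fun g t =>
    exist S (aop (fun i => proj1_sig (t i)))
            (hS g (fun i => proj1_sig (t i)) (fun i => proj2_sig (t i)))).

Inductive word (X : Type) : Type :=
| Letter of X
| App (g : opsym T) of ('I_(arity g) -> word X).

Definition word_alg (X : Type) : algebra := @Algebra (word X) (@App X).

Fixpoint word_map (X Z : Type) (f : X -> Z) (w : word X) : word Z :=
  match w with
  | Letter x => Letter (f x)
  | App g t => App (fun i => word_map f (t i))
  end.

Record congruence (A : algebra) (R : set (A * A)) : Prop := Congruence {
  cong_equiv : equivalence (fun a b => R (a, b));
  cong_op : forall (g : opsym T) (s t : 'I_(arity g) -> A),
    (forall i, R (s i, t i)) -> R (aop s, aop t) }.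

Definition cong_gen (A : algebra) (S : set (A * A)) : set (A * A) :=
  smallest (@congruence A) S.

Lemma cong_gen_congruence (A : algebra) (S : set (A * A)) :
  congruence (cong_gen S).
Proof.
split; first split.
- by move=> a R [[e _] _]; exact: (equiv_refl e).
- move=> a b ab R hR; case: (hR) => -[e _] _.
  exact: (equiv_sym e (ab R hR)).
- move=> a b c ab bc R hR; case: (hR) => -[e _] _.
  by exact: (equiv_trans e (ab R hR) (bc R hR)).
- move=> g s t st R hR; case: (hR) => -[_ o] _.
  by apply: o => i; exact: st.
Qed.

Section QuotAlg.
Variables (A : algebra) (R : set (A * A)) (hR : congruence R).

(* The operations go through representatives; see [quot_op]. *)
Definition quot_alg : algebra :=
  @Algebra (quot (cong_equiv hR))
    (fun g t => cls (cong_equiv hR) (aop (fun i => rep (t i)))).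

Definition qcls (a : A) : quot_alg := cls (cong_equiv hR) a.

Lemma quot_op : homomorphism qcls.
Proof.
move=> g t; apply/clsP; apply: (cong_op hR) => i.
exact: (equiv_sym (cong_equiv hR) (rep_cls (cong_equiv hR) (t i))).
Qed.

End QuotAlg.

Section Variety.
Variables (Y : Type) (Sigma : set (word Y * word Y)).

Definition in_variety (A : algebra) : Prop :=
  forall w w', Sigma (w, w') ->
  forall phi : word_alg Y -> A, homomorphism phi -> phi w = phi w'.

Definition variety_nontrivial : Prop :=
  exists2 A : algebra, in_variety A & exists a b : A, a <> b.

Definition Phi (X : Type) : set (word_alg X * word_alg X) :=
  cong_gen [set p | exists w w' (phi : word_alg Y -> word_alg X),
    [/\ Sigma (w, w'), homomorphism phi & p = (phi w, phi w')]].

Definition freeV (X : Type) : algebra :=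
  quot_alg (cong_gen_congruence _ : congruence (@Phi X)).

Definition clsPhi (X : Type) (w : word X) : freeV X :=
  @qcls (word_alg X) (@Phi X) (cong_gen_congruence _) w.

Definition ThetaV (C : palgebra) : set (freeV C * freeV C) :=
  cong_gen [set p | exists (g : opsym T) (c : 'I_(arity g) -> C) (d : C),
    pop c = Some d /\
    p = (aop (fun i => clsPhi (Letter (c i))), clsPhi (Letter d))].

Definition WV (C : palgebra) : algebra :=
  quot_alg (cong_gen_congruence _ : congruence (@ThetaV C)).

Definition clsTheta (C : palgebra) (u : freeV C) : WV C :=
  @qcls (freeV C) (@ThetaV C) (cong_gen_congruence _) u.

End Variety.
End UniversalAlgebra.

Arguments Letter {T X} _.
Arguments clsPhi {T Y} Sigma {X} w.
Arguments clsTheta {T Y Sigma C} u.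

Section PartialActions.
Variable G : groupType.
Local Open Scope group_scope.

(* [theta x a = Some b] means that theta(x,a) is defined and equals b. *)
Record paction (A : Type) : Type := PAction {
  pact :> G -> A -> option A;
  pact1 : forall a, pact 1 a = Some a;
  pactV : forall x a b, pact x a = Some b -> pact x^-1 b = Some a;
  pactM : forall x y a b c,
    pact y a = Some b -> pact x b = Some c -> pact (x * y) a = Some c }.

Definition global (A : Type) (theta : paction A) : Prop :=
  forall x a, exists b, theta x a = Some b.

Definition pdom (A : Type) (theta : paction A) (x : G) : set A :=
  [set b | exists a, theta x a = Some b].

Section Envelope.
Variables (A : Type) (theta : paction A).

Definition env_rel (p q : G * A) : Prop :=
  theta (q.1^-1 * p.1) p.2 = Some q.2.

Lemma env_equiv : equivalence env_rel.
Proof.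
split.
- by move=> [x a]; rewrite /env_rel /= mulVg pact1.
- move=> [x a] [y b]; rewrite /env_rel /= => h.
  by have := pactV h; rewrite invgM invgK.
- move=> [x a] [y b] [z c]; rewrite /env_rel /= => h1 h2.
  by have := pactM h1 h2; rewrite -mulgA mulVKg.
Qed.

Definition AU : Type := quot env_equiv.

Definition clsU (x : G) (a : A) : AU := cls env_equiv (x, a).

Definition thetaU (x : G) (u : AU) : AU :=
  clsU (x * (rep u).1) (rep u).2.

Lemma clsU_eq x a y b : clsU x a = clsU y b <-> theta (y^-1 * x) a = Some b.
Proof. exact: clsP. Qed.

Lemma thetaUE x y a : thetaU x (clsU y a) = clsU (x * y) a.
Proof.
apply/clsU_eq; have := rep_cls env_equiv (y, a); rewrite /env_rel /=.
by rewrite invgM -mulgA mulKg.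
Qed.

End Envelope.

Variable T : algtype.

Record pact_alg : Type := PactAlg {
  palg :> algebra T;
  pa_act : paction palg }.

Section EnvelopeAlgebra.
Variable P : pact_alg.
Local Notation theta := (pa_act P).

(* (x, a) is chosen among the presentations t = ([x,a_1],...,[x,a_n]); the
   value does not depend on it, see [AU_opE]. *)
Definition AU_op (g : opsym T) (t : 'I_(arity g) -> AU theta) :
    option (AU theta) :=
  match pselect (exists p : G * ('I_(arity g) -> P),
                   t = fun i => clsU theta p.1 (p.2 i)) with
  | left h => let p := projT1 (cid h) in Some (clsU theta p.1 (aop p.2))
  | right _ => None
  end.

Definition AU_alg : palgebra T := PAlgebra AU_op.

Definition thetaUbar (x : G) : word T AU_alg -> word T AU_alg :=
  word_map (thetaU (theta := theta) x).

Definition letterU (x : G) (a : P) : word T AU_alg :=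
  Letter (clsU theta x a).

End EnvelopeAlgebra.

Section Categories.
Variables (Y : Type) (Sigma : set (word T Y * word T Y)).

Definition pA (P : pact_alg) : Prop :=
  in_variety Sigma P /\
  exists hD : forall x, subalgebra (pdom (pa_act P) x),
  forall x, exists2 f : subalg (hD x^-1) -> subalg (hD x),
    (forall a, pa_act P x (proj1_sig a) = Some (proj1_sig (f a)))
    & isomorphism f.

Definition glA (P : pact_alg) : Prop := pA P /\ global (pa_act P).

Definition pA_morphism (P Q : pact_alg) (phi : P -> Q) : Prop :=
  homomorphism phi /\
  forall x a b, pa_act P x a = Some b -> pa_act Q x (phi a) = Some (phi b).

(* The subcategory is full, given by its class [D] of objects. *)
Definition reflector (D : pact_alg -> Prop) (P R : pact_alg) (eps : P -> R) :
    Prop :=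
  [/\ D R, pA_morphism eps
    & forall Q : pact_alg, D Q -> forall phi : P -> Q, pA_morphism phi ->
      exists! psi : R -> Q, pA_morphism psi /\ psi \o eps = phi].

Lemma pA_op (P : pact_alg) : pA P ->
  forall x (g : opsym T) (s t : 'I_(arity g) -> P),
    (forall i, pa_act P x (s i) = Some (t i)) ->
    pa_act P x (aop s) = Some (aop t).
Proof.
move=> [_ [hD hf]] x g s t st; have [f fE [fhom _]] := hf x.
have sD i : pdom (pa_act P) x^-1 (s i) by exists (t i); apply: pactV.
pose s' i : subalg (hD x^-1) := exist _ (s i) (sD i).
have := fE (aop s'); rewrite fhom /= => ->; congr (Some (aop _)).
by apply/funext => i /=; have := fE (s' i); rewrite st => -[].
Qed.

Lemma AU_opE (P : pact_alg) : pA P ->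
  forall x (g : opsym T) (a : 'I_(arity g) -> P),
    @pop T (AU_alg P) g (fun i => clsU (pa_act P) x (a i))
    = Some (clsU (pa_act P) x (aop a)).
Proof.
move=> hP x g a; rewrite /= /AU_op; case: pselect => [h|[]]; last by exists (x, a).
case: (cid h) => -[y b] /= yb; congr Some; apply/esym/clsU_eq.
by apply: pA_op => // i; apply/clsU_eq; exact: (congr1 (fun t => t i) yb).
Qed.

End Categories.
End PartialActions.

(* Main.v *)
Require Import Defs.
From mathcomp Require Import all_boot.
From mathcomp Require Import boolp classical_sets.

(** Everything follows from one universal property, [WV_ext_hom] and
    [WV_hom_eq]: homomorphisms from W_V(C) into an algebra B of V are the same
    as maps C -> B that preserve the operations of the partial algebra C
    wherever these are defined ([partial_hom]).  Indeed such a map extends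
    uniquely to words, the extension identifies the two sides of every
    identity because B lies in V, and the two sides of every defining pair of
    Theta because the map preserves the defined operations; so it factors
    through both quotients.

    The action.  The defined operations of A^U combine elements [x,a_i] with a
    common x, and translating them by y only replaces x by yx; hence each
    theta^U(y,-) preserves them ([thetaU_partial]), and therefore induces an
    endomorphism of W_V(A^U).  On classes of words this endomorphism applies
    theta^U(y,-) to the letters, from which the laws of a global action
    follow.

    The reflection.  Let phi : A -> Q be a morphism into a global object.  An
    equivariant map with [1,a] |-> phi(a) must send [x,a] = x[1,a] to x phi(a).
    This rule is well defined because phi respects the partial action, and it
    preserves the defined operations because x acts on Q by a homomorphism
    ([env_ext_partial]).  The induced homomorphism on W_V(A^U) is the required
    factorization.  It is unique, since the letters [x,a] generate W_V(A^U). *)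

Set Implicit Arguments.
Unset Strict Implicit.
Unset Printing Implicit Defensive.

Local Open Scope classical_set_scope.
Local Open Scope group_scope.

(** * Free algebras and quotients *)

Section UniversalAlgebra.
Variable T : algtype.

Fixpoint word_ext (X : Type) (B : algebra T) (f : X -> B) (w : word_alg T X) : B :=
  match w with
  | Letter x => f x
  | App g t => aop (fun i => word_ext f (t i))
  end.

Lemma word_ext_hom (X : Type) (B : algebra T) (f : X -> B) :
  homomorphism (word_ext f).
Proof. by []. Qed.

Lemma word_hom_eq (X : Type) (B : algebra T) (h k : word_alg T X -> B) :
  homomorphism h -> homomorphism k ->
  (forall x, h (Letter x) = k (Letter x)) -> forall w, h w = k w.
Proof.
move=> hh hk hkL; elim=> [x|g t IH]; first exact: hkL.
rewrite (hh g t) (hk g t); congr aop.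
by apply/funext => i; exact: IH.
Qed.

Lemma homomorphism_comp (A B C : algebra T) (k : B -> C) (h : A -> B) :
  homomorphism k -> homomorphism h -> homomorphism (k \o h).
Proof. by move=> hk hh g t; rewrite /= hh hk. Qed.

Lemma word_map_id (X : Type) (w : word T X) : word_map id w = w.
Proof. by elim: w => //= g t IH; congr App; apply/funext. Qed.

Lemma word_map_comp (X Y Z : Type) (f : Y -> Z) (e : X -> Y) (w : word T X) :
  word_map f (word_map e w) = word_map (f \o e) w.
Proof. by elim: w => //= g t IH; congr App; apply/funext. Qed.

Lemma word_ext_map (X Z : Type) (B : algebra T) (h : word_alg T Z -> B)
    (e : X -> Z) (w : word T X) :
  homomorphism h ->
  word_ext (fun x => h (Letter (e x))) w = h (word_map e w).
Proof.
move=> hh; elim: w => //= g t IH.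
by rewrite (hh g); congr aop; apply/funext.
Qed.

(** The kernel of a homomorphism is a congruence. *)
Lemma cong_gen_hom (A B : algebra T) (S : set (A * A)) (h : A -> B) :
  homomorphism h -> (forall a b, S (a, b) -> h a = h b) ->
  forall a b, cong_gen S (a, b) -> h a = h b.
Proof.
move=> hh hS a b /(_ [set p | h p.1 = h p.2]); apply.
split; last by move=> [c d] /hS.
split; first by split=> //= c d e -> ->.
move=> g s t st /=; rewrite !hh; congr aop.
by apply/funext => i; exact: st.
Qed.

Section QuotientLift.
Variables (A : algebra T) (R : set (A * A)) (hR : congruence R).

Lemma qcls_surj (u : quot_alg hR) : exists a, qcls hR a = u.
Proof. by exists (rep u); exact: repK. Qed.

Lemma qcls_eq (a b : A) : R (a, b) -> qcls hR a = qcls hR b.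
Proof. by move=> Rab; apply/clsP. Qed.

Definition quot_lift (B : algebra T) (h : A -> B) (u : quot_alg hR) : B :=
  h (rep u).

Variables (B : algebra T) (h : A -> B).
Hypothesis hker : forall a b, R (a, b) -> h a = h b.

Lemma quot_liftE (a : A) : quot_lift h (qcls hR a) = h a.
Proof. by apply: hker; exact: (rep_cls (cong_equiv hR) a). Qed.

Lemma quot_lift_hom : homomorphism h -> homomorphism (quot_lift h).
Proof. by move=> hh g t; rewrite /= quot_liftE hh. Qed.

End QuotientLift.

(** Words are projective: choose preimages of the letters. *)
Lemma word_hom_lift (Y : Type) (A : algebra T) (R : set (A * A))
    (hR : congruence R) (phi : word_alg T Y -> quot_alg hR) :
  homomorphism phi ->
  exists2 psi : word_alg T Y -> A, homomorphism psi
    & forall w, phi w = qcls hR (psi w).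
Proof.
move=> hphi; exists (word_ext (fun y => rep (phi (Letter y)))) => //.
apply: (word_hom_eq hphi) => [|y].
  by apply: homomorphism_comp (word_ext_hom _); exact: quot_op.
by rewrite /qcls /= repK.
Qed.

Section Variety.
Variables (Y : Type) (Sigma : set (word T Y * word T Y)).

Lemma quot_in_variety (A : algebra T) (R : set (A * A)) (hR : congruence R) :
  in_variety Sigma A -> in_variety Sigma (quot_alg hR).
Proof.
move=> hA w w' ww' phi /word_hom_lift[psi hpsi phiE].
by rewrite !phiE (hA w w').
Qed.

Lemma freeV_in_variety (X : Type) : in_variety Sigma (freeV Sigma X).
Proof.
move=> w w' ww' phi /word_hom_lift[psi hpsi phiE].
rewrite !phiE; apply: qcls_eq => R [_]; apply.
by exists w, w', psi.
Qed.

Lemma WV_in_variety (C : palgebra T) : in_variety Sigma (WV Sigma C).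
Proof. by apply: quot_in_variety; exact: freeV_in_variety. Qed.

(** * The universal property of W_V(C) *)

Definition partial_hom (C : palgebra T) (B : algebra T) (f : C -> B) : Prop :=
  forall (g : opsym T) (c : 'I_(arity g) -> C) (d : C),
    pop c = Some d -> f d = aop (f \o c).

Definition WV_ext (C : palgebra T) (B : algebra T) (f : C -> B) :
    WV Sigma C -> B :=
  quot_lift (quot_lift (word_ext f)).

Definition clsW (C : palgebra T) (w : word T C) : WV Sigma C :=
  clsTheta (clsPhi Sigma w).

Lemma clsW_hom (C : palgebra T) :
  homomorphism (@clsW C : word_alg T C -> WV Sigma C).
Proof.
apply: (@homomorphism_comp (word_alg T C) (freeV Sigma C) (WV Sigma C)
         clsTheta (clsPhi Sigma)); exact: quot_op.
Qed.

Lemma clsW_surj (C : palgebra T) (u : WV Sigma C) : exists w, clsW w = u.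
Proof.
have [v <-] := qcls_surj u; have [w <-] := qcls_surj v.
by exists w.
Qed.

Lemma clsW_letter_partial (C : palgebra T) :
  partial_hom (fun c : C => clsW (Letter c)).
Proof.
move=> g c d cd; apply/esym.
rewrite -[RHS]/(clsTheta (clsPhi Sigma (Letter d))).
transitivity (clsTheta (aop (fun i => clsPhi Sigma (Letter (c i)))) : WV Sigma C).
  by rewrite /clsTheta quot_op.
by apply: qcls_eq => R [_]; apply; exists g, c, d.
Qed.

Lemma WV_hom_eq (C : palgebra T) (B : algebra T) (h k : WV Sigma C -> B) :
  homomorphism h -> homomorphism k ->
  (forall c, h (clsW (Letter c)) = k (clsW (Letter c))) -> forall u, h u = k u.
Proof.
move=> hh hk hkL u; have [w <-] := clsW_surj u.
by apply: (@word_hom_eq C B (h \o @clsW C) (k \o @clsW C)) => //;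
  apply: homomorphism_comp => //; exact: clsW_hom.
Qed.

Section Extension.
Variables (C : palgebra T) (B : algebra T) (f : C -> B).
Hypotheses (hB : in_variety Sigma B) (hf : partial_hom f).

Lemma word_ext_Phi (w w' : word_alg T C) :
  Phi Sigma (w, w') -> word_ext f w = word_ext f w'.
Proof.
apply: (@cong_gen_hom (word_alg T C) B _ _ (word_ext_hom f)) => _ _ [v [v' [phi [vv' hphi [-> ->]]]]].
apply: (hB vv' (phi := word_ext f \o phi)).
exact: (@homomorphism_comp _ (word_alg T C) B (word_ext f) phi).
Qed.

Let ext_freeV : freeV Sigma C -> B := quot_lift (word_ext f).

Let ext_freeV_hom : homomorphism ext_freeV.
Proof. exact: (quot_lift_hom (A := word_alg T C) word_ext_Phi). Qed.

Let ext_freeV_Theta (u v : freeV Sigma C) :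
  ThetaV (u, v) -> ext_freeV u = ext_freeV v.
Proof.
apply: (cong_gen_hom ext_freeV_hom) => _ _ [g [c [d [cd [-> ->]]]]].
rewrite ext_freeV_hom /ext_freeV /clsPhi quot_liftE /=; last exact: word_ext_Phi.
rewrite (hf cd); congr aop; apply/funext => i /=.
by rewrite quot_liftE //; exact: word_ext_Phi.
Qed.

Lemma WV_extE (w : word T C) : WV_ext f (clsW w) = word_ext f w.
Proof.
rewrite /WV_ext /clsW /clsTheta quot_liftE; last exact: ext_freeV_Theta.
by rewrite /clsPhi quot_liftE //; exact: word_ext_Phi.
Qed.

Lemma WV_ext_hom : homomorphism (WV_ext f).
Proof. exact: quot_lift_hom ext_freeV_Theta ext_freeV_hom. Qed.

End Extension.
End Variety.
End UniversalAlgebra.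

(** * Partial actions *)

Section PartialActions.
Variables (G : groupType) (T : algtype).

(** Converse of [pA_op]: closure of the domains under the operations, and the
    homomorphism property of the bijections between them, are together the
    compatibility of the partial action with the operations. *)
Lemma pA_of_op (Y : Type) (Sigma : set (word T Y * word T Y))
    (P : pact_alg G T) :
  in_variety Sigma P ->
  (forall x (g : opsym T) (s t : 'I_(arity g) -> P),
    (forall i, pa_act P x (s i) = Some (t i)) ->
    pa_act P x (aop s) = Some (aop t)) ->
  pA Sigma P.
Proof.
move=> hP hop; split=> //.
have hD x : subalgebra (pdom (pa_act P) x).
  move=> g t ht; exists (aop (fun i => projT1 (cid (ht i)))).
  by apply: hop => i; exact: projT2 (cid (ht i)).
exists hD => x.
have hV y (a : P) : pdom (pa_act P) y^-1 a ->
    {b | pa_act P y a = Some b}.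
  by move=> /cid[b ba]; exists b; rewrite -(invgK y); exact: pactV.
have sig_eq y (a b : subalg (hD y)) : proj1_sig a = proj1_sig b -> a = b.
  exact: eq_sig_hprop (fun _ => @Prop_irrelevance _) a b.
pose F y (a : subalg (hD y^-1)) : subalg (hD y) :=
  exist _ (projT1 (hV y _ (proj2_sig a)))
    (ex_intro _ (proj1_sig a) (projT2 (hV y _ (proj2_sig a)))).
have FE y a : pa_act P y (proj1_sig a) = Some (proj1_sig (F y a)).
  exact: projT2 (hV y _ (proj2_sig a)).
exists (F x) => //; split.
  move=> g t; apply: sig_eq; apply: Some_inj.
  by rewrite -FE; apply: hop => i; exact: FE.
have hW (b : P) : pdom (pa_act P) x b -> {a | pa_act P x a = Some b}.
  exact: cid.
exists (fun b => exist _ (projT1 (hW _ (proj2_sig b)))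
    (ex_intro _ (proj1_sig b) (pactV (projT2 (hW _ (proj2_sig b))))))
  => [a|b]; apply: sig_eq; apply: Some_inj.
- rewrite -(pactV (FE x a)); apply/esym/pactV.
  exact: projT2 (hW _ (proj2_sig (F x a))).
- by rewrite -FE; exact: projT2 (hW _ (proj2_sig b)).
Qed.

Section Envelope.
Variables (A : Type) (theta : paction G A).

Lemma clsU_surj (u : AU theta) : exists x a, clsU theta x a = u.
Proof.
by exists (rep u).1, (rep u).2; rewrite /clsU -surjective_pairing repK.
Qed.

Lemma thetaU1 : thetaU 1 = id :> (AU theta -> AU theta).
Proof.
by apply/funext => u; have [x [a <-]] := clsU_surj u; rewrite thetaUE mul1g.
Qed.

Lemma thetaUM (x y : G) :
  thetaU x \o thetaU y = thetaU (x * y) :> (AU theta -> AU theta).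
Proof.
apply/funext => u; have [z [a <-]] := clsU_surj u.
by rewrite /= !thetaUE mulgA.
Qed.

End Envelope.

(** * The action on W_V(A^U) *)

Section EnvelopeAlgebra.
Variables (Y : Type) (Sigma : set (word T Y * word T Y)).
Variables (P : pact_alg G T) (hP : pA Sigma P).
Local Notation theta := (pa_act P).
Local Notation W := (WV Sigma (AU_alg P)).

Lemma AU_opP (g : opsym T) (c : 'I_(arity g) -> AU_alg P) (d : AU_alg P) :
  pop c = Some d ->
  exists x (a : 'I_(arity g) -> P),
    c = (fun i => clsU theta x (a i)) /\ d = clsU theta x (aop a).
Proof.
rewrite /= /AU_op; case: pselect => // h [<-].
by case: (cid h) => -[x a] /= ->; exists x, a.
Qed.

Lemma thetaU_partial (x : G) (g : opsym T) (c : 'I_(arity g) -> AU_alg P)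
    (d : AU_alg P) :
  pop c = Some d -> pop (thetaU x \o c : _ -> AU_alg P) = Some (thetaU x d).
Proof.
move=> /AU_opP[y [a [-> ->]]]; rewrite thetaUE -(AU_opE hP).
by congr pop; apply/funext => i /=; rewrite thetaUE.
Qed.

Definition thetaV (x : G) : W -> W :=
  WV_ext (fun u : AU_alg P => clsW Sigma (Letter (thetaU x u) : word T (AU_alg P))).

Lemma thetaV_letter_partial (x : G) :
  partial_hom (fun u : AU_alg P =>
    clsW Sigma (Letter (thetaU x u) : word T (AU_alg P))).
Proof.
by move=> g c d /(thetaU_partial x)/(@clsW_letter_partial _ _ Sigma).
Qed.

Lemma thetaV_hom (x : G) : homomorphism (thetaV x).
Proof.
by apply: WV_ext_hom; [exact: WV_in_variety | exact: thetaV_letter_partial].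
Qed.

Lemma thetaVE (x : G) (w : word T (AU_alg P)) :
  thetaV x (clsW Sigma w) = clsW Sigma (thetaUbar x w).
Proof.
rewrite /thetaV WV_extE; first last.
- exact: thetaV_letter_partial.
- exact: WV_in_variety.
exact: word_ext_map (clsW_hom Sigma (C := AU_alg P)).
Qed.

Lemma thetaV1 (u : W) : thetaV 1 u = u.
Proof.
have [w <-] := clsW_surj u.
by rewrite thetaVE /thetaUbar thetaU1 word_map_id.
Qed.

Lemma thetaVM (x y : G) (u : W) : thetaV x (thetaV y u) = thetaV (x * y) u.
Proof.
have [w <-] := clsW_surj u.
by rewrite !thetaVE /thetaUbar word_map_comp thetaUM.
Qed.

Definition thetaUV : paction G W.
Proof.
apply: (@PAction G W (fun x u => Some (thetaV x u))).
- by move=> u; rewrite thetaV1.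
- by move=> x u _ [<-]; rewrite thetaVM mulVg thetaV1.
- by move=> x y u _ _ [<-] [<-]; rewrite thetaVM.
Defined.

Local Notation R := (PactAlg thetaUV).

Lemma thetaUV_glA : glA Sigma R.
Proof.
split; last by move=> x u; exists (thetaV x u).
apply: pA_of_op => [|x g s t st]; first exact: WV_in_variety.
have -> : t = thetaV x \o s by apply/funext => i; have [] := st i.
by congr Some; exact: thetaV_hom.
Qed.

Definition epsV (a : P) : R := clsW Sigma (letterU 1 a).

Lemma thetaV_eps (x : G) (a : P) : thetaV x (epsV a) = clsW Sigma (letterU x a).
Proof. by rewrite thetaVE /thetaUbar /letterU /= thetaUE mulg1. Qed.

Lemma epsV_morphism : pA_morphism epsV.
Proof.
split=> [g t|x a b ab].
  exact: clsW_letter_partial (AU_opE hP 1 t).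
rewrite -[LHS]/(Some (thetaV x (epsV a))) thetaV_eps /epsV /letterU.
suff -> : clsU theta x a = clsU theta 1 b by [].
by apply/clsU_eq; rewrite invg1 mul1g.
Qed.

(** * The reflection property *)

Section Reflection.
Variables (Q : pact_alg G T) (hQ : glA Sigma Q).
Variables (phi : P -> Q) (hphi : pA_morphism phi).

Definition env_ext (u : AU_alg P) : Q :=
  projT1 (cid (hQ.2 (rep u).1 (phi (rep u).2))).

(** If (y,b) represents [x,a] then (x^-1 y) b = a in A, so the same holds for
    the images in Q, and y phi(b) = x phi(a). *)
Lemma env_extE (x : G) (a : P) :
  pa_act Q x (phi a) = Some (env_ext (clsU theta x a)).
Proof.
rewrite /env_ext; case: cid => q /=.
have := rep_cls (env_equiv theta) (x, a); rewrite /env_rel -/(clsU theta x a).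
case: (rep _) => y b /= /hphi.2 ba yb; have [q' aq'] := hQ.2 x (phi a).
by have := pactM ba aq'; rewrite mulVKg yb aq' => -[->].
Qed.

Lemma env_extM (x : G) (u : AU_alg P) :
  pa_act Q x (env_ext u) = Some (env_ext (thetaU x u)).
Proof.
have [y [a <-]] := clsU_surj u; have [q xq] := hQ.2 x (env_ext (clsU theta y a)).
by rewrite thetaUE -env_extE (pactM (env_extE y a) xq).
Qed.

Lemma env_ext_partial : partial_hom env_ext.
Proof.
move=> g c d /AU_opP[x [a [-> ->]]]; apply: Some_inj.
rewrite -env_extE hphi.1; apply: (pA_op hQ.1) => i.
exact: env_extE.
Qed.

Definition reflV : R -> Q := WV_ext env_ext.

Lemma reflV_hom : homomorphism reflV.
Proof. by apply: WV_ext_hom; [exact: hQ.1.1 | exact: env_ext_partial]. Qed.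

Lemma reflV_letter (u : AU_alg P) :
  reflV (clsW Sigma (Letter u : word T (AU_alg P))) = env_ext u.
Proof. by rewrite /reflV WV_extE //; [exact: hQ.1.1 | exact: env_ext_partial]. Qed.

Lemma reflV_eps (a : P) : reflV (epsV a) = phi a.
Proof. by apply: Some_inj; rewrite reflV_letter -env_extE pact1. Qed.

(** The homomorphisms x o psi and psi o x out of W_V(A^U) agree on letters. *)
Lemma reflV_morphism : pA_morphism reflV.
Proof.
split=> [|x u _ [<-]]; first exact: reflV_hom.
pose k v := projT1 (cid (hQ.2 x (reflV v))).
have kE v : pa_act Q x (reflV v) = Some (k v) by rewrite /k; case: cid.
rewrite kE; congr Some; move: u.
apply: (WV_hom_eq (k := reflV \o thetaV x)).
- move=> g t; apply: Some_inj; rewrite -kE reflV_hom.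
  by apply: (pA_op hQ.1) => i; exact: kE.
- exact: homomorphism_comp reflV_hom (thetaV_hom x).
- by move=> u; apply: Some_inj; rewrite -kE /comp thetaVE !reflV_letter env_extM.
Qed.

Lemma refl_unique (psi psi' : R -> Q) :
  pA_morphism psi -> pA_morphism psi' -> psi \o epsV = psi' \o epsV ->
  psi = psi'.
Proof.
move=> [hpsi epsi] [hpsi' epsi'] E; apply/funext.
apply: WV_hom_eq => // u; have [x [a <-]] := clsU_surj u.
have xE : pa_act R x (epsV a) = Some (clsW Sigma (letterU x a)).
  by rewrite /= thetaV_eps.
apply: Some_inj; rewrite -(epsi _ _ _ xE) -(epsi' _ _ _ xE).
by congr (pa_act Q x _); exact: (congr1 (fun f => f a) E).
Qed.

End Reflection.
End EnvelopeAlgebra.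
End PartialActions.

Theorem corollary3p25 (G : groupType) (T : algtype) (Y : Type)
    (Sigma : set (word T Y * word T Y))
    (hV : variety_nontrivial Sigma)
    (P : pact_alg G T) (hP : pA Sigma P) :
  exists thetaUV : paction G (WV Sigma (AU_alg P)),
    (forall (x : G) (w : word T (AU_alg P)),
        thetaUV x (clsTheta (clsPhi Sigma w))
        = Some (clsTheta (clsPhi Sigma (thetaUbar x w))))
    /\ reflector (glA Sigma) (R := PactAlg thetaUV)
         (fun a : P => clsTheta (clsPhi Sigma (letterU 1 a))).
Proof.
exists (thetaUV hP); split=> [x w|].
  by congr Some; exact: (thetaVE hP).
split; [exact: thetaUV_glA | exact: epsV_morphism |].
move=> Q hQ phi hphi; exists (reflV hQ phi).
have psiE : reflV hQ phi \o epsV hP = phi.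
  by apply/funext => a; exact: reflV_eps.
split; first by split=> //; exact: reflV_morphism.
move=> psi [hpsi psi_eps]; apply: (refl_unique (hP := hP)) => //.
- exact: reflV_morphism.
- by rewrite psiE.
Qed.
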